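(* Let $F$ be a field such that the quaternion algebra $E(F)$ is a division ring, regarded as a four-dimensional algebra over $F$ with basis $e_0=1$, $e_1=i$, $e_2=j$, $e_3=k$. Then in this basis the structural constants ${}_{pq}B^{r}$ (defined by $e_pe_q=\sum_r{}_{pq}B^{r}e_r$) have the form $${}_{00}B^{0}=1,\ {}_{01}B^{1}=1,\ {}_{02}B^{2}=1,\ {}_{03}B^{3}=1,$$ $${}_{10}B^{1}=1,\ {}_{11}B^{0}=-1,\ {}_{12}B^{3}=1,\ {}_{13}B^{2}=-1,$$ $${}_{20}B^{2}=1,\ {}_{21}B^{3}=-1,\ {}_{22}B^{0}=-1,\ {}_{23}B^{1}=1,$$ $${}_{30}B^{3}=1,\ {}_{31}B^{2}=1,\ {}_{32}B^{1}=-1,\ {}_{33}B^{0}=-1$$ (all others being $0$). Moreover the standard components $f^{pq}\in F$ of an additive function $f:E(F)\to E(F)$ over the field $F$ and the coordinates ${}_pf^{q}\in F$ of the corresponding $F$-linear map satisfy the following relationships: (0) ${}_0f^0=f^{00}-f^{11}-f^{22}-f^{33}$, ${}_1f^1=f^{00}-f^{11}+f^{22}+f^{33}$, ${}_2f^2=f^{00}+f^{11}-f^{22}+f^{33}$, ${}_3f^3=f^{00}+f^{11}+f^{22}-f^{33}$; $4f^{00}={}_0f^0+{}_1f^1+{}_2f^2+{}_3f^3$, $4f^{11}=-{}_0f^0-{}_1f^1+{}_2f^2+{}_3f^3$, $4f^{22}=-{}_0f^0+{}_1f^1-{}_2f^2+{}_3f^3$, $4f^{33}=-{}_0f^0+{}_1f^1+{}_2f^2-{}_3f^3$;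 (1) ${}_0f^1=f^{01}+f^{10}+f^{23}-f^{32}$, ${}_1f^0=-f^{01}-f^{10}+f^{23}-f^{32}$, ${}_2f^3=-f^{01}+f^{10}-f^{23}-f^{32}$, ${}_3f^2=f^{01}-f^{10}-f^{23}-f^{32}$; $4f^{10}=-{}_1f^0+{}_0f^1-{}_3f^2+{}_2f^3$, $4f^{01}=-{}_1f^0+{}_0f^1+{}_3f^2-{}_2f^3$, $4f^{32}=-{}_1f^0-{}_0f^1-{}_3f^2-{}_2f^3$, $4f^{23}={}_1f^0+{}_0f^1-{}_3f^2-{}_2f^3$; (2) ${}_0f^2=f^{02}-f^{13}+f^{20}+f^{31}$, ${}_1f^3=f^{02}-f^{13}-f^{20}-f^{31}$, ${}_2f^0=-f^{02}-f^{13}-f^{20}+f^{31}$, ${}_3f^1=-f^{02}-f^{13}+f^{20}-f^{31}$; $4f^{20}=-{}_2f^0+{}_3f^1+{}_0f^2-{}_1f^3$, $4f^{31}={}_2f^0-{}_3f^1+{}_0f^2-{}_1f^3$, $4f^{02}=-{}_2f^0-{}_3f^1+{}_0f^2+{}_1f^3$, $4f^{13}=-{}_2f^0-{}_3f^1-{}_0f^2-{}_1f^3$; (3) ${}_0f^3=f^{03}+f^{12}-f^{21}+f^{30}$, ${}_1f^2=-f^{03}-f^{12}-f^{21}+f^{30}$, ${}_2f^1=f^{03}-f^{12}-f^{21}-f^{30}$, ${}_3f^0=-f^{03}+f^{12}-f^{21}-f^{30}$; $4f^{30}=-{}_3f^0-{}_2f^1+{}_1f^2+{}_0f^3$, $4f^{21}=-{}_3f^0-{}_2f^1-{}_1f^2-{}_0f^3$,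 $4f^{12}={}_3f^0-{}_2f^1-{}_1f^2+{}_0f^3$, $4f^{03}=-{}_3f^0+{}_2f^1-{}_1f^2+{}_0f^3$.
   Context: $E(F)$ is the algebra of elements $x^0+x^1i+x^2j+x^3k$, $x^p\in F$, with $i^2=j^2=k^2=-1$, $ij=k=-ji$, $jk=i=-kj$, $ki=j=-ik$. An additive function $f$ of $E(F)$ over $F$ (with the identity map as generator) is written in standard representation as $f(x)=\sum_{p,q}f^{pq}\,e_p\,x\,e_q$ with $f^{pq}\in F$; the $f^{pq}$ are its standard components over $F$. As an $F$-linear map, $f$ has coordinates ${}_pf^{q}\in F$ defined by $f\big(\sum_p a^pe_p\big)=\sum_{p,q}a^p\,{}_pf^{q}\,e_q$, $a^p\in F$. *)

(* Defs.v *)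
From HB Require Import structures.
From mathcomp Require Import all_boot all_order all_algebra.
From mathcomp Require Import ring.

Set Implicit Arguments.
Unset Strict Implicit.
Unset Printing Implicit Defensive.

Import GRing.Theory.
Local Open Scope ring_scope.

(* The element x^0 + x^1 i + x^2 j + x^3 k of E(F). *)
Record quat (F : Type) := Quat { qre : F; qim : F; qjm : F; qkm : F }.

Definition quat_to_tuple (F : Type) (x : quat F) : F * F * F * F :=
  (qre x, qim x, qjm x, qkm x).
Definition quat_of_tuple (F : Type) (t : F * F * F * F) : quat F :=
  Quat t.1.1.1 t.1.1.2 t.1.2 t.2.

Lemma quat_to_tupleK (F : Type) :
  cancel (@quat_to_tuple F) (@quat_of_tuple F).
Proof. by case. Qed.

HB.instance Definition _ (F : choiceType) :=
  Choice.copy (quat F) (can_type (@quat_to_tupleK F)).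

Section QuatAlgebra.
Variable F : fieldType.
Implicit Types x y z : quat F.

Definition addq x y :=
  Quat (qre x + qre y) (qim x + qim y) (qjm x + qjm y) (qkm x + qkm y).
Definition oppq x := Quat (- qre x) (- qim x) (- qjm x) (- qkm x).
Definition zeroq : quat F := Quat 0 0 0 0.

Lemma addqA : associative addq.
Proof. by move=> x y z; congr Quat; rewrite addrA. Qed.
Lemma addqC : commutative addq.
Proof. by move=> x y; congr Quat; rewrite addrC. Qed.
Lemma add0q : left_id zeroq addq.
Proof. by case=> a b c d; congr Quat; rewrite add0r. Qed.
Lemma addNq : left_inverse zeroq oppq addq.
Proof. by case=> a b c d; congr Quat; rewrite addNr. Qed.

HB.instance Definition _ :=
  GRing.isZmodule.Build (quat F) addqA addqC add0q addNq.

(* The F-bilinear extension of i^2 = j^2 = k^2 = -1, ij = k = -ji,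
   jk = i = -kj, ki = j = -ik; see the lemmas [quat_ii] ... [quat_ik]. *)
Definition mulq x y := Quat
  (qre x * qre y - qim x * qim y - qjm x * qjm y - qkm x * qkm y)
  (qre x * qim y + qim x * qre y + qjm x * qkm y - qkm x * qjm y)
  (qre x * qjm y - qim x * qkm y + qjm x * qre y + qkm x * qim y)
  (qre x * qkm y + qim x * qjm y - qjm x * qim y + qkm x * qre y).
Definition oneq : quat F := Quat 1 0 0 0.

Lemma mulqA : associative mulq.
Proof. by case=> ? ? ? ? [? ? ? ?] [? ? ? ?]; congr Quat => /=; ring. Qed.
Lemma mul1q : left_id oneq mulq.
Proof. by case=> ? ? ? ?; congr Quat => /=; ring. Qed.
Lemma mulq1 : right_id oneq mulq.
Proof. by case=> ? ? ? ?; congr Quat => /=; ring. Qed.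
Lemma mulqDl : left_distributive mulq +%R.
Proof. by case=> ? ? ? ? [? ? ? ?] [? ? ? ?]; congr Quat => /=; ring. Qed.
Lemma mulqDr : right_distributive mulq +%R.
Proof. by case=> ? ? ? ? [? ? ? ?] [? ? ? ?]; congr Quat => /=; ring. Qed.
Lemma oneq_neq0 : oneq != 0.
Proof. by apply/eqP => -[] /eqP; rewrite oner_eq0. Qed.

HB.instance Definition _ := GRing.Zmodule_isNzRing.Build (quat F)
  mulqA mul1q mulq1 mulqDl mulqDr oneq_neq0.

Definition scaleq (a : F) x :=
  Quat (a * qre x) (a * qim x) (a * qjm x) (a * qkm x).

Lemma scaleqA a b x : scaleq a (scaleq b x) = scaleq (a * b) x.
Proof. by congr Quat; rewrite mulrA. Qed.
Lemma scale1q : left_id 1 scaleq.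
Proof. by case=> ? ? ? ?; congr Quat; rewrite mul1r. Qed.
Lemma scaleqDr : right_distributive scaleq +%R.
Proof. by move=> a x y; congr Quat; rewrite mulrDr. Qed.
Lemma scaleqDl x : {morph scaleq^~ x : a b / a + b}.
Proof. by move=> a b; congr Quat; rewrite mulrDl. Qed.

HB.instance Definition _ := GRing.Zmodule_isLmodule.Build F (quat F)
  scaleqA scale1q scaleqDr scaleqDl.

Lemma scaleqAl (a : F) x y : a *: (x * y) = a *: x * y.
Proof. by case: x y => ? ? ? ? [? ? ? ?]; congr Quat => /=; ring. Qed.
Lemma scaleqAr (a : F) x y : a *: (x * y) = x * (a *: y).
Proof. by case: x y => ? ? ? ? [? ? ? ?]; congr Quat => /=; ring. Qed.

HB.instance Definition _ := GRing.Lmodule_isLalgebra.Build F (quat F) scaleqAl.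
HB.instance Definition _ := GRing.Lalgebra_isAlgebra.Build F (quat F) scaleqAr.

Definition quat_to_row x : 'rV[F]_4 :=
  \row_p tnth [tuple qre x; qim x; qjm x; qkm x] p.
Definition quat_of_row (u : 'rV[F]_4) : quat F :=
  Quat (u 0 0) (u 0 1) (u 0 2) (u 0 3).

Lemma quat_vect_axiom : Vector.axiom 4 (quat F).
Proof.
exists quat_to_row.
  move=> a x y; apply/rowP; case; do 4?[case=> [|] //];
    by move=> lt; rewrite !mxE !(tnth_nth 0).
exists quat_of_row.
  by case=> *; rewrite /quat_of_row !mxE !(tnth_nth 0).
move=> u; apply/rowP => p; rewrite !mxE !(tnth_nth 0).
by case: p; do 4?[case=> [|] //] => lt /=; congr (u _ _); apply/val_inj.
Qed.

HB.instance Definition _ := Lmodule_hasFinDim.Build F (quat F) quat_vect_axiom.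

Definition qi : quat F := Quat 0 1 0 0.
Definition qj : quat F := Quat 0 0 1 0.
Definition qk : quat F := Quat 0 0 0 1.

Definition quat_basis : 4.-tuple (quat F) := [tuple 1; qi; qj; qk].

End QuatAlgebra.

Arguments qi {F}.
Arguments qj {F}.
Arguments qk {F}.

Definition qe (F : fieldType) (p : 'I_4) : quat F := tnth (quat_basis F) p.
Arguments qe {F} p.

Section QuatFacts.
Variable F : fieldType.

Let quatE := (addr0, add0r, subr0, sub0r, mulr0, mul0r, mulr1, mul1r, oppr0).

Lemma quat_ii : qi * qi = -1 :> quat F.
Proof. by congr Quat; rewrite /= !quatE. Qed.
Lemma quat_jj : qj * qj = -1 :> quat F.
Proof. by congr Quat; rewrite /= !quatE. Qed.
Lemma quat_kk : qk * qk = -1 :> quat F.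
Proof. by congr Quat; rewrite /= !quatE. Qed.
Lemma quat_ij : qi * qj = qk :> quat F.
Proof. by congr Quat; rewrite /= !quatE. Qed.
Lemma quat_ji : qj * qi = - qk :> quat F.
Proof. by congr Quat; rewrite /= !quatE. Qed.
Lemma quat_jk : qj * qk = qi :> quat F.
Proof. by congr Quat; rewrite /= !quatE. Qed.
Lemma quat_kj : qk * qj = - qi :> quat F.
Proof. by congr Quat; rewrite /= !quatE. Qed.
Lemma quat_ki : qk * qi = qj :> quat F.
Proof. by congr Quat; rewrite /= !quatE. Qed.
Lemma quat_ik : qi * qk = - qj :> quat F.
Proof. by congr Quat; rewrite /= !quatE. Qed.

Lemma quat_decomp (x : quat F) :
  x = (qre x)%:A + qim x *: qi + qjm x *: qj + qkm x *: qk.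
Proof. by case: x => *; congr Quat; rewrite /= !quatE. Qed.

Lemma quat_basisP : basis_of fullv (quat_basis F).
Proof.
rewrite basisEdim size_tuple dimvf leqnn andbT.
apply/subvP => x _; rewrite (quat_decomp x).
by rewrite !rpredD ?rpredZ ?memv_span ?inE ?eqxx ?orbT.
Qed.

End QuatFacts.

(* MathComp has no structure of possibly noncommutative division rings;
   1 != 0 is part of [nzRingType]. *)
Definition is_division_ring (R : nzRingType) : Prop :=
  forall x : R, x != 0 -> exists y : R, y * x = 1 /\ x * y = 1.

(* B p q r stands for the constant written _{pq}B^r. *)
Definition structural_constants (F : fieldType)
    (B : 'I_4 -> 'I_4 -> 'I_4 -> F) : Prop :=
  forall p q : 'I_4, qe p * qe q = \sum_r B p q r *: qe r.

(* s p q stands for f^{pq}. *)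
Definition standard_components (F : fieldType) (f : quat F -> quat F)
    (s : 'M[F]_4) : Prop :=
  forall x : quat F, f x = \sum_p \sum_q s p q *: (qe p * x * qe q).

(* c p q stands for _pf^q. *)
Definition linear_coordinates (F : fieldType) (f : quat F -> quat F)
    (c : 'M[F]_4) : Prop :=
  forall a : 'I_4 -> F,
    f (\sum_p a p *: qe p) = \sum_p \sum_q (a p * c p q) *: qe q.

(* Main.v *)
Require Import Defs.
From HB Require Import structures.
From mathcomp Require Import all_boot all_order all_algebra.
From mathcomp Require Import ring.

(** Reading off the coefficient of [e_r] is an [F]-linear form on [E(F)], and
    applying it to a defining equation determines every quantity in play. It
    turns [e_p e_q = \sum_r B p q r e_r] into the fact that [B p q r] is the
    [r]-th coefficient of [e_p e_q] ([structural_constantE]), and, evaluating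
    the linear map at [e_p], it gives
      [c p q = \sum_m \sum_n s m n * (coefficient of e_q in e_m e_p e_n)]
    ([linear_coordinateE]). Each product [e_m e_p e_n] is plus or minus a basis
    element, so these sums are signed sums of four of the [s m n]. The sixteen
    equations split into four independent 4 x 4 systems, indexed by the class
    of [(p, q)] in the Klein four-group formed by the basis up to sign. In each
    system the matrix is a Hadamard matrix [H], with [H^T H = 4], and that is
    why the inverse formulas carry a factor 4 and hold without dividing by it,
    in any characteristic. *)

Set Implicit Arguments.
Unset Strict Implicit.
Unset Printing Implicit Defensive.

Import GRing.Theory.
Local Open Scope ring_scope.


(** Destructing an index produces raw [Ordinal] terms, whereas formulas in the
    coordinates use the numerals of the ring ['I_4]; this principle, like
    [big_ord4] for sums, splits into cases that are phrased with numerals. *)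
Lemma ord4_ind (P : 'I_4 -> Prop) :
  P 0 -> P 1 -> P 2 -> P 3 -> forall p, P p.
Proof.
move=> P0 P1 P2 P3 [[|[|[|[|//]]]] lt];
  [move: P0 | move: P1 | move: P2 | move: P3];
  by congr P; apply/val_inj.
Qed.

Lemma big_ord4 (V : nmodType) (G : 'I_4 -> V) :
  \sum_p G p = G 0 + G 1 + G 2 + G 3.
Proof.
rewrite !big_ord_recl big_ord0 addr0 !addrA.
by do !congr (_ + _); congr G; apply/val_inj.
Qed.

Section Coordinates.
Variable F : fieldType.
Implicit Types (x y : quat F) (p q r : 'I_4).

(** An untyped sequence is used, rather than a tuple, because its entry at a
    numeral index reduces by computation; as [r < 4], the default value [0] is
    never returned. *)
Definition quat_coord r x : F := [:: qre x; qim x; qjm x; qkm x]`_r.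

Lemma quat_coord_linear r : scalar (quat_coord r).
Proof. by move=> a x y; elim/ord4_ind: r. Qed.

HB.instance Definition _ r :=
  GRing.isLinear.Build F (quat F) F *%R (quat_coord r) (quat_coord_linear r).

Lemma quat_coord_qe r p : quat_coord r (qe p) = (r == p)%:R.
Proof. by elim/ord4_ind: r; elim/ord4_ind: p. Qed.

Lemma quat_coord_sum r (a : 'I_4 -> F) :
  quat_coord r (\sum_p a p *: qe p) = a r.
Proof.
rewrite linear_sum (bigD1 r) //= linearZ /= quat_coord_qe eqxx mulr1.
rewrite big1 ?addr0 // => p /negPf p_neq_r.
by rewrite linearZ /= quat_coord_qe eq_sym p_neq_r mulr0.
Qed.

(** Multiplication in the basis determines the structural constants, since the
    forms [quat_coord r] separate the terms of the defining sum. *)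
Lemma structural_constantE B p q r :
  structural_constants B -> B p q r = quat_coord r (qe p * qe q).
Proof. by move=> ->; rewrite quat_coord_sum. Qed.

(** Both representations of [f] are evaluated at [qe p], where the coordinate
    vector [a] is a Kronecker delta and only row [p] of [c] survives; the form
    [quat_coord q] then isolates a single entry of that row. *)
Lemma linear_coordinateE (f : quat F -> quat F) (s c : 'M[F]_4) p q :
    standard_components f s -> linear_coordinates f c ->
  c p q = \sum_m \sum_n s m n * quat_coord q (qe m * qe p * qe n).
Proof.
move=> fs fc; have fe : f (qe p) = \sum_q c p q *: qe q.
  have -> : qe p = \sum_m (m == p)%:R *: qe m :> quat F.
    rewrite (bigD1 p) //= eqxx scale1r big1 ?addr0 // => m /negPf ->.
    by rewrite scale0r.
  rewrite fc (bigD1 p) //= eqxx [X in _ + X]big1 ?addr0 => [|m /negPf ->].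
    by apply: eq_bigr => n _; rewrite mul1r.
  by apply: big1 => n _; rewrite mul0r scale0r.
rewrite -(quat_coord_sum q (c p)) -fe fs linear_sum; apply: eq_bigr => m _.
by rewrite linear_sum; apply: eq_bigr => n _; rewrite linearZ.
Qed.

End Coordinates.

Theorem theorem13p2 (F : fieldType) (HE : is_division_ring (quat F)) :
  (forall B : 'I_4 -> 'I_4 -> 'I_4 -> F, structural_constants B ->
     (B 0 0 0 = 1 /\ B 0 1 1 = 1 /\ B 0 2 2 = 1 /\ B 0 3 3 = 1 /\
      B 1 0 1 = 1 /\ B 1 1 0 = -1 /\ B 1 2 3 = 1 /\ B 1 3 2 = -1 /\
      B 2 0 2 = 1 /\ B 2 1 3 = -1 /\ B 2 2 0 = -1 /\ B 2 3 1 = 1 /\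
      B 3 0 3 = 1 /\ B 3 1 2 = 1 /\ B 3 2 1 = -1 /\ B 3 3 0 = -1) /\
     (forall p q r : 'I_4,
        (p, q, r) \notin
         [:: (0, 0, 0); (0, 1, 1); (0, 2, 2); (0, 3, 3);
          (1, 0, 1); (1, 1, 0); (1, 2, 3); (1, 3, 2);
          (2, 0, 2); (2, 1, 3); (2, 2, 0); (2, 3, 1);
          (3, 0, 3); (3, 1, 2); (3, 2, 1); (3, 3, 0)] ->
        B p q r = 0))
  /\
  (forall (f : {linear quat F -> quat F}) (s c : 'M[F]_4),
     standard_components f s -> linear_coordinates f c ->
     (c 0 0 = s 0 0 - s 1 1 - s 2 2 - s 3 3 /\
      c 1 1 = s 0 0 - s 1 1 + s 2 2 + s 3 3 /\
      c 2 2 = s 0 0 + s 1 1 - s 2 2 + s 3 3 /\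
      c 3 3 = s 0 0 + s 1 1 + s 2 2 - s 3 3 /\
      4 * s 0 0 = c 0 0 + c 1 1 + c 2 2 + c 3 3 /\
      4 * s 1 1 = - c 0 0 - c 1 1 + c 2 2 + c 3 3 /\
      4 * s 2 2 = - c 0 0 + c 1 1 - c 2 2 + c 3 3 /\
      4 * s 3 3 = - c 0 0 + c 1 1 + c 2 2 - c 3 3) /\
     (c 0 1 = s 0 1 + s 1 0 + s 2 3 - s 3 2 /\
      c 1 0 = - s 0 1 - s 1 0 + s 2 3 - s 3 2 /\
      c 2 3 = - s 0 1 + s 1 0 - s 2 3 - s 3 2 /\
      c 3 2 = s 0 1 - s 1 0 - s 2 3 - s 3 2 /\
      4 * s 1 0 = - c 1 0 + c 0 1 - c 3 2 + c 2 3 /\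
      4 * s 0 1 = - c 1 0 + c 0 1 + c 3 2 - c 2 3 /\
      4 * s 3 2 = - c 1 0 - c 0 1 - c 3 2 - c 2 3 /\
      4 * s 2 3 = c 1 0 + c 0 1 - c 3 2 - c 2 3) /\
     (c 0 2 = s 0 2 - s 1 3 + s 2 0 + s 3 1 /\
      c 1 3 = s 0 2 - s 1 3 - s 2 0 - s 3 1 /\
      c 2 0 = - s 0 2 - s 1 3 - s 2 0 + s 3 1 /\
      c 3 1 = - s 0 2 - s 1 3 + s 2 0 - s 3 1 /\
      4 * s 2 0 = - c 2 0 + c 3 1 + c 0 2 - c 1 3 /\
      4 * s 3 1 = c 2 0 - c 3 1 + c 0 2 - c 1 3 /\
      4 * s 0 2 = - c 2 0 - c 3 1 + c 0 2 + c 1 3 /\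
      4 * s 1 3 = - c 2 0 - c 3 1 - c 0 2 - c 1 3) /\
     (c 0 3 = s 0 3 + s 1 2 - s 2 1 + s 3 0 /\
      c 1 2 = - s 0 3 - s 1 2 - s 2 1 + s 3 0 /\
      c 2 1 = s 0 3 - s 1 2 - s 2 1 - s 3 0 /\
      c 3 0 = - s 0 3 + s 1 2 - s 2 1 - s 3 0 /\
      4 * s 3 0 = - c 3 0 - c 2 1 + c 1 2 + c 0 3 /\
      4 * s 2 1 = - c 3 0 - c 2 1 - c 1 2 - c 0 3 /\
      4 * s 1 2 = c 3 0 - c 2 1 - c 1 2 + c 0 3 /\
      4 * s 0 3 = - c 3 0 + c 2 1 - c 1 2 + c 0 3)).
Proof.
split=> [B /structural_constantE BE | f s c fs fc].
  split=> [|p q r].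
    by do !split; rewrite BE /quat_coord /=; ring.
  elim/ord4_ind: p; elim/ord4_ind: q; elim/ord4_ind: r => // _;
    by rewrite BE /quat_coord /=; ring.
(* Once [c] is expressed through [s], the formulas for [4 * s m n] need no
   inversion of a linear system: they are polynomial identities in [s]. *)
have cE p q := linear_coordinateE p q fs fc.
by do !split; rewrite !cE !big_ord4 /quat_coord /=; ring.
Qed.
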